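(* Let $E/F$ be a finite field extension and let $\{O_{v_i}\}_{1\le i\le k}$ be a finite set of valuation rings of $F$ which are pairwise independent, where $v_i$ is a valuation on $F$ with valuation ring $O_{v_i}$ and value group $\Gamma_i$. Let $\{R_i\}_{1\le i\le k}$ be a finite set of subrings of $E$ such that the field of fractions of each $R_i$ is $E$ and $R_i\cap F=O_{v_i}$ for every $1\le i\le k$. For every $1\le i\le k$ let $w_i:E\to M_i\cup\{\infty\}$ be a quasi-valuation on $E$ with $w_i\in\mathcal W_{R_i}$, i.e. $w_i$ extends $v_i$ and $O_{w_i}=R_i$. Let $x_1,\dots,x_k\in E$ and let $m_1,\dots,m_k$ be elements with $m_i\in M_i^G$ for every $1\le i\le k$. Then there exists an element $x\in E$ such that $$w_i(x-x_i)\ge m_i\quad\text{for all }1\le i\le k.$$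
   Context: A quasi-valuation on a ring $A$ is a function $w:A\to M\cup\{\infty\}$, where $M$ is a totally ordered abelian monoid (written additively, the order being compatible with addition) to which an element $\infty$ greater than all elements of $M$ is adjoined (with $m+\infty=\infty$), such that $w(0)=\infty$, $w(xy)\ge w(x)+w(y)$ and $w(x+y)\ge\min\{w(x),w(y)\}$ for all $x,y\in A$. If $w$ is a quasi-valuation on $E$, its quasi-valuation ring is $O_w=\{x\in E\mid w(x)\ge 0\}$. ''$w_i$ extends $v_i$'' means $w_i|_F=v_i$, where $\Gamma_i$ is an ordered submonoid of $M_i$. $\mathcal W_{R_i}$ denotes the class of all quasi-valuations $w$ on $E$ extending $v_i$ with $O_w=R_i$. $M_i^G=\{m\in M_i\mid \text{there exists } 0\ne y\in E \text{ with } m\le w_i(y)\}$. Two subrings $A,B$ of $F$ are called independent if $AB=F$, where $AB$ is the set of finite sums of products $ab$ with $a\in A$, $b\in B$. Pairwise independent means $O_{v_i}O_{v_j}=F$ for all $i\ne j$. *)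

(* Defs.v *)
From HB Require Import structures.
From mathcomp Require Import all_boot all_order all_algebra all_field.

Set Implicit Arguments.
Unset Strict Implicit.
Unset Printing Implicit Defensive.

Import Order.TTheory GRing.Theory Num.Theory.
Local Open Scope ring_scope.

(* The order is bundled here rather than taken from Order.Total: Hierarchy
   Builder admits no common extension of Nmodule and Order.Total next to
   Num.POrderedZmodule. *)
HB.mixin Record Nmodule_isOrdered M of GRing.Nmodule M := {
  oleq : rel M;
  oleq_refl : reflexive oleq;
  oleq_anti : antisymmetric oleq;
  oleq_trans : transitive oleq;
  oleq_total : total oleq;
  oleq_add2r : forall c a b : M, oleq a b -> oleq (a + c) (b + c)
}.

#[short(type="orderedNmodType")]
HB.structure Definition OrderedNmodule :=
  { M of Nmodule_isOrdered M & GRing.Nmodule M }.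

#[short(type="orderedZmodType")]
HB.structure Definition OrderedZmodule :=
  { M of OrderedNmodule M & GRing.Zmodule M }.

(* M together with an adjoined infinity, encoded as None. *)
Definition with_infty (M : Type) : Type := option M.

Definition Fin (M : Type) (m : M) : with_infty M := Some m.
Definition Infty (M : Type) : with_infty M := None.
Arguments Infty {M}.

Section WithInfty.
Variable M : orderedNmodType.
Implicit Types x y z : with_infty M.

Definition infty_le x y : bool :=
  match x, y with
  | _, None => true
  | None, Some _ => false
  | Some a, Some b => oleq a b
  end.

Definition infty_add x y : with_infty M :=
  match x, y with
  | Some a, Some b => Fin (a + b)
  | _, _ => Infty
  end.

Fact infty_le_refl : reflexive infty_le.
Proof. by case=> //= a; apply: oleq_refl. Qed.

Fact infty_le_anti : antisymmetric infty_le.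
Proof. by move=> [a|] [b|] //= /oleq_anti ->. Qed.

Fact infty_le_trans : transitive infty_le.
Proof. by move=> [b|] [a|] [c|] //=; apply: oleq_trans. Qed.

Fact infty_le_total : total infty_le.
Proof. by move=> [a|] [b|] //=; apply: oleq_total. Qed.

Fact infty_addA : associative infty_add.
Proof. by move=> [a|] [b|] [c|] //=; rewrite addrA. Qed.

Fact infty_addC : commutative infty_add.
Proof. by move=> [a|] [b|] //=; rewrite addrC. Qed.

Fact infty_add0 : left_id (Fin 0) infty_add.
Proof. by move=> [a|] //=; rewrite add0r. Qed.

HB.instance Definition _ := Choice.copy (with_infty M) (option M).
HB.instance Definition _ := GRing.isNmodule.Build (with_infty M)
  infty_addA infty_addC infty_add0.
HB.instance Definition _ := Order.Le_isPOrder.Build ring_display (with_infty M)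
  infty_le_refl infty_le_anti infty_le_trans.
HB.instance Definition _ := Order.POrder_isTotal.Build ring_display
  (with_infty M) infty_le_total.

End WithInfty.

Record is_valuation (F : fieldType) (G : orderedZmodType)
    (v : F -> with_infty G) : Prop := IsValuation {
  valuation_infty : forall x, v x = Infty <-> x = 0;
  valuationM : forall x y, v (x * y) = v x + v y;
  valuationD : forall x y, Num.min (v x) (v y) <= v (x + y)
}.

Definition has_value_group (F : fieldType) (G : orderedZmodType)
    (v : F -> with_infty G) : Prop :=
  forall g : G, exists x, v x = Fin g.

Record is_quasi_valuation (A : nzRingType) (M : orderedNmodType)
    (w : A -> with_infty M) : Prop := IsQuasiValuation {
  quasi_valuation0 : w 0 = Infty;
  quasi_valuationM : forall x y, w x + w y <= w (x * y);
  quasi_valuationD : forall x y, Num.min (w x) (w y) <= w (x + y)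
}.

(* O_w; a valuation ring when w is a valuation, a quasi-valuation ring when w
   is a quasi-valuation. *)
Definition val_ring (A : nzRingType) (M : orderedNmodType)
    (w : A -> with_infty M) : {pred A} :=
  [pred x | Fin 0 <= w x].

Definition prod_set (F : nzRingType) (A B : {pred F}) (x : F) : Prop :=
  exists (n : nat) (a b : 'I_n -> F),
    (forall j, a j \in A /\ b j \in B) /\ x = \sum_(j < n) a j * b j.

Definition independent (F : fieldType) (A B : {pred F}) : Prop :=
  forall x, prod_set A B x.

Definition has_fraction_field (E : fieldType) (R : {pred E}) : Prop :=
  forall x, exists a b, [/\ a \in R, b \in R, b != 0 & x = a / b].

(* The inclusion of the value group G of v in M as an ordered submonoid is the
   explicit order embedding iota. *)
Definition extends (F : fieldType) (E : fieldExtType F)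
    (G : orderedZmodType) (M : orderedNmodType) (iota : {additive G -> M})
    (v : F -> with_infty G) (w : E -> with_infty M) : Prop :=
  {mono iota : a b / oleq a b} /\ forall a : F, w a%:A = omap iota (v a).

(* The class W_R of quasi-valuations on E extending v with O_w = R. *)
Definition in_W (F : fieldType) (E : fieldExtType F)
    (G : orderedZmodType) (M : orderedNmodType) (iota : {additive G -> M})
    (v : F -> with_infty G) (R : {pred E}) (w : E -> with_infty M) : Prop :=
  [/\ is_quasi_valuation w, extends iota v w & val_ring w =i R].

(* The set M^G attached to w : E -> M u {infty}. *)
Definition in_MG (E : fieldType) (M : orderedNmodType)
    (w : E -> with_infty M) (m : M) : Prop :=
  exists y : E, y != 0 /\ Fin m <= w y.

(* Main.v *)
Require Import Defs.
From mathcomp Require Import all_boot all_order all_algebra all_field.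
From HB Require Import structures.
From mathcomp Require Import ring.
From Stdlib Require Import Classical_Prop.
Import Order.TTheory GRing.Theory Num.Theory.
Local Open Scope ring_scope.

(** The proof transports weak approximation from [F] to [E].

    First, each bound [m i] may be replaced by the value of a nonzero scalar.
    Since [E] is algebraic over [F] and is the fraction field of [R i], every
    element of [E] is carried into [R i] by some nonzero scalar: a denominator
    [b] satisfies [b^-1 = p.[b]] with [p] a polynomial over [F], so a common
    denominator of the coefficients of [p] clears [b^-1]
    ([fraction_denominator]).  If [m i <= w i y] with [y != 0] and [d *: y^-1]
    lies in [R i], then [w i d >= w i y + w i (d *: y^-1) >= m i].  Hence it
    is enough to find [x] with [x - x_ i] in [d i *: R i] for all [i], a
    condition on the rings alone ([simultaneous_approximation]).

    Next, choose scalars [e i] in [O i] with [e i *: x_ j] in [R i] for all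
    [j].  If the scalars [t j] are so close to Kronecker deltas that
    [t j - (j == i)] lies in [d i * e i * O i] for all [i], then
    [x := \sum_j t j *: x_ j] has the required property.

    Such [t j] exist by weak approximation in [F] ([weak_approximation]).
    For two independent rings, writing the inverse of [f * g] as a product of
    elements of the two rings gives an element that is small (divisible by [f])
    in one and large (of inverse divisible by [g]) in the other
    ([small_and_large]).  An induction on the number of rings gives [u] that
    is large at [i] and small at all [j != i] ([large_at_one]), and then
    [u / (1 + u)] is near [1] at [i] and near [0] elsewhere. *)

(** * Valuation subrings of a field *)

(** For a subring of a field this characterizes valuation rings.  The trivial
    valuation ring, the whole field, is included. *)
Definition valuative (F : fieldType) (O : {pred F}) : Prop :=
  forall x, x \in O \/ x^-1 \in O.

(** The generic sum [a b + a' b'] is [(a b / b' + a') b'] when [b / b'] lies in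
    [A], and symmetrically otherwise, so sums of products collapse. *)
Lemma prod_set_mul (F : fieldType) (A B : subringClosed F) (x : F) :
  valuative F A -> prod_set A B x ->
  exists a b, [/\ a \in A, b \in B & x = a * b].
Proof.
move=> valA [n [a [b [ab ->]]]] {x}.
apply: (big_ind (fun x => exists a b, [/\ a \in A, b \in B & x = a * b])).
- by exists 0, 0; rewrite !rpred0 mulr0.
- move=> _ _ [c [d [cA dB ->]]] [c' [d' [c'A d'B ->]]].
  have [->|d0] := eqVneq d 0; first by exists c', d'; rewrite mulr0 add0r.
  have [->|d'0] := eqVneq d' 0; first by exists c, d; rewrite mulr0 addr0.
  case: (valA (d / d')) => [dA | /[!invf_div] dA].
    exists (c * (d / d') + c'), d'; split=> //; last by field.
    by rewrite rpredD 1?rpredM.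
  exists (c + c' * (d' / d)), d; split=> //; last by field.
  by rewrite rpredD 1?rpredM.
- by move=> i _; have [aA bB] := ab i; exists (a i), (b i).
Qed.

Lemma small_and_large (F : fieldType) (A B : subringClosed F) (f g : F) :
  valuative F A -> independent A B -> f != 0 -> g != 0 ->
  exists u, [/\ u != 0, u / f \in A & (u * g)^-1 \in B].
Proof.
move=> valA AB f0 g0.
have [a [b [aA bB fgE]]] := prod_set_mul F A B (f * g)^-1 valA (AB _).
have: (f * g)^-1 != 0 by rewrite invr_neq0 ?mulf_neq0.
rewrite fgE mulf_eq0 negb_or => /andP[a0 b0].
exists (f * a); split; first by rewrite mulf_neq0.
- by rewrite mulrAC divff ?mul1r.
- suff -> : (f * a * g)^-1 = b by [].
  have -> : f * a * g = a * (f * g) by ring.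
  by rewrite invfM fgE mulKf.
Qed.

(** For a valuation ring [O] that is not the whole field and [g != 0], this
    amounts to [g] having positive valuation, and [1 + y] is then a unit.  The guard [1 + y != 0] makes it hold
    also in the trivial valuation ring, where no element has positive valuation;
    this is what allows trivial valuations among the given ones. *)
Definition deep (F : fieldType) (O : {pred F}) (g : F) : Prop :=
  forall y, y / g \in O -> 1 + y != 0 -> (1 + y)^-1 \in O.

Lemma nonunit_deep (F : fieldType) (O : subringClosed F) (p : F) :
  valuative F O -> p != 0 -> p^-1 \notin O -> deep F O p.
Proof.
move=> valO p0 pVN y yp y1.
case: (valO (p / (1 + y))) => [py | /[!invf_div] py].
  have -> : (1 + y)^-1 = 1 - y / p * (p / (1 + y)) by field; rewrite y1 p0.
  by rewrite rpredB 1?rpredM ?rpred1.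
case/negP: pVN; have -> : p^-1 = (1 + y) / p - y / p by field.
by rewrite rpredB.
Qed.

Lemma deep_exists (F : fieldType) (O : subringClosed F) (f : F) :
  valuative F O -> f != 0 ->
  exists g, [/\ g != 0, g \in O, g / f \in O & deep F O g].
Proof.
move=> valO f0.
have [h [h0 hO hf]] : exists h, [/\ h != 0, h \in O & h / f \in O].
  case: (valO f) => fO; [exists f | exists 1]; split=> //.
  - by rewrite divff ?rpred1.
  - exact: oner_neq0.
  - exact: rpred1.
  - by rewrite mul1r.
have [[p [p0 pO pVN]]|noNonunit] :=
  classic (exists p, [/\ p != 0, p \in O & p^-1 \notin O]).
  exists (p * h); split; first by rewrite mulf_neq0.
  - by rewrite rpredM.
  - by rewrite -mulrA rpredM.
  - move=> y yph; apply: (nonunit_deep F O p) => //.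
    have -> : y / p = y / (p * h) * h by field; rewrite p0 h0.
    by rewrite rpredM.
(* Here [O] is the whole field. *)
exists h; split=> // y yh y1.
case: (valO (1 + y)) => // yO; case: (boolP (_ \in O)) => // yVN.
by case: noNonunit; exists (1 + y).
Qed.

(** * Weak approximation for independent valuation rings *)

Section WeakApproximation.
Context (F : fieldType) (k : nat) (O : 'I_k -> subringClosed F).
Hypothesis valO : forall i, valuative F (O i).
Hypothesis indepO : forall i j, i != j -> independent (O i) (O j).

Lemma deep_family (f : 'I_k -> F) : (forall i, f i != 0) ->
  exists g : 'I_k -> F, forall i,
    [/\ g i != 0, g i \in O i, g i / f i \in O i & deep F (O i) (g i)].
Proof.
move=> f0.
exact: (fin_all_exists (fun i => deep_exists F (O i) (f i) (valO i) (f0 i))).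
Qed.

(** To add an index [n] to [s], take [u'] large at [i] and small at [n], then
    [u] large at [i] and so small on [s] that it compensates the values of [u']
    there.  If [u] is integral at [n], then [u * u'] works.  Otherwise [u] has a
    pole at [n], and [u / (1 + u)] is integral at [n] while it keeps the
    smallness of [u] on [s] and has integral inverse at [i]; it then replaces
    [u]. *)
Lemma large_at_one (i : 'I_k) (s : seq 'I_k) (f : 'I_k -> F) :
  i \notin s -> (forall j, f j != 0) ->
  exists u, [/\ u != 0, (u * f i)^-1 \in O i &
                forall j, j \in s -> u / f j \in O j].
Proof.
elim: s f => [|n s IHs] f; first move=> _ f0.
  by exists (f i)^-1; rewrite invr_neq0 ?mulVf ?invr1 ?rpred1.
rewrite inE negb_or => /andP[in_ iNs] f0.
have ni : n != i by rewrite eq_sym.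
have [u' [u'0 u'n u'i]] :=
  small_and_large F (O n) (O i) (f n) (f i) (valO n) (indepO n i ni) (f0 n)
    (f0 i).
have fu'0 j : f j / u' != 0 by rewrite mulf_neq0 ?invr_neq0.
have [g gP] := deep_family (fun j => f j / u') fu'0.
have g0 j : g j != 0 by have [] := gP j.
have [u [u0 ui us]] := IHs g iNs g0.
have uVi : u^-1 \in O i.
  have [_ gO _ _] := gP i.
  have -> : u^-1 = (u * g i)^-1 * g i by field; rewrite u0 g0.
  by rewrite rpredM.
have uu's j : j \in s -> u * u' / f j \in O j.
  move=> js; have [_ _ gu' _] := gP j.
  have -> : u * u' / f j = u / g j * (g j / (f j / u')).
    by field; rewrite f0 g0 u'0.
  by rewrite rpredM ?us.
have [un|uNn] := boolP (u \in O n).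
  exists (u * u'); split; first by rewrite mulf_neq0.
    by rewrite -mulrA invfM rpredM.
  move=> j; rewrite inE => /predU1P[->|/uu's//].
  by rewrite -mulrA rpredM.
have u1N : 1 + u \notin O n.
  apply: contra uNn => u1n; have -> : u = (1 + u) - 1 by ring.
  by rewrite rpredB ?rpred1.
have u1 : 1 + u != 0 by apply: contraNneq u1N => ->; rewrite rpred0.
have u1V : (1 + u)^-1 \in O n.
  by case: (valO n (1 + u)) => // u1n; rewrite u1n in u1N.
exists (u / (1 + u) * u'); split; first by rewrite !mulf_neq0 ?invr_neq0.
  have -> : (u / (1 + u) * u' * f i)^-1 = (1 + u^-1) * (u' * f i)^-1.
    by field; rewrite u0 u'0 f0 u1.
  by rewrite rpredM ?rpredD ?rpred1.
move=> j; rewrite inE => /predU1P[->|js].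
  rewrite -mulrA rpredM //.
  have -> : u / (1 + u) = 1 - (1 + u)^-1 by field.
  by rewrite rpredB ?rpred1.
have [_ _ _ deepg] := gP j.
have -> : u / (1 + u) * u' / f j = u * u' / f j * (1 + u)^-1.
  by field; rewrite f0 u1.
by rewrite rpredM ?uu's ?deepg ?us.
Qed.

Lemma weak_approximation (i : 'I_k) (f : 'I_k -> F) : (forall j, f j != 0) ->
  exists t, forall j, (t - (i == j)%:R) / f j \in O j.
Proof.
move=> f0; have [g gP] := deep_family f f0.
have g0 j : g j != 0 by have [] := gP j.
have iNs : i \notin rem i (enum 'I_k) by rewrite mem_rem_uniqF ?enum_uniq.
have [u [u0 ui us]] := large_at_one i _ g iNs g0.
have {}us j : i != j -> u / g j \in O j.
  by move=> ij; rewrite us // mem_rem_uniq ?enum_uniq // !inE eq_sym ij mem_enum.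
have [u1|u1] := eqVneq (1 + u) 0.
  (* Here [u = -1] is a unit in every ring, so all the bounds [f j] with
     [j != i] divide [1] and [t = 1] satisfies them. *)
  exists 1 => j; have [<-|ij] := eqVneq i j.
    by rewrite subrr mul0r rpred0.
  have [_ _ gf _] := gP j; rewrite subr0.
  have uE : u = -1 by apply/eqP; rewrite -addr_eq0 addrC u1.
  have -> : 1 / f j = - (u / g j) * (g j / f j).
    by rewrite uE; field; rewrite f0 g0.
  by rewrite rpredM ?rpredN ?us.
exists (u / (1 + u)) => j; have [_ _ gf deepg] := gP j.
have [ij|ij] := eqVneq i j.
  rewrite -ij in gf deepg *.
  have -> : (u / (1 + u) - 1%:R) / f i =
      - ((u * g i)^-1 * (g i / f i) * (1 + u^-1)^-1).
    by field; rewrite f0 g0 u0 addrC u1.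
  rewrite rpredN rpredM ?deepg -?invfM //; first by rewrite rpredM.
  have -> : 1 + u^-1 = (1 + u) / u by field.
  by rewrite mulf_neq0 ?invr_neq0.
rewrite subr0.
have -> : u / (1 + u) / f j = u / g j * (g j / f j) * (1 + u)^-1.
  by field; rewrite f0 g0 u1.
by rewrite rpredM ?deepg ?us // rpredM ?us.
Qed.

End WeakApproximation.

(** * Denominators in the base field *)

Section Denominators.
Context (F : fieldType) (E : fieldExtType F).
Context (O : subringClosed F) (R : subringClosed E).
Hypothesis valO : valuative F O.
Hypothesis RO : forall a : F, (a%:A \in R) = (a \in O).

Lemma rpredZ_base (a : F) (z : E) : a \in O -> z \in R -> a *: z \in R.
Proof. by move=> aO zR; rewrite -mulr_algl rpredM ?RO. Qed.

Definition denominator (d : F) (z : E) : Prop :=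
  [/\ d != 0, d \in O & d *: z \in R].

Lemma common_denominator (s : seq E) :
  (forall z, z \in s -> exists d, denominator d z) ->
  exists d, [/\ d != 0, d \in O & forall z, z \in s -> d *: z \in R].
Proof.
elim: s => [|z s IHs] denom.
  by exists 1; rewrite oner_neq0 rpred1.
have [d [d0 dO dz]] := denom z (mem_head _ _).
have [|e [e0 eO es]] := IHs.
  by move=> y ys; apply: denom; rewrite inE ys orbT.
exists (d * e); split; rewrite ?mulf_neq0 1?rpredM // => y.
rewrite inE => /predU1P[->|ys]; last by rewrite -scalerA rpredZ_base ?es.
by rewrite mulrC -scalerA rpredZ_base.
Qed.

Lemma base_denominator (c : F) : exists d, denominator d c%:A.
Proof.
case: (valO c) => cO.
  by exists 1; rewrite /denominator oner_neq0 rpred1 scale1r RO.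
have [->|c0] := eqVneq c 0.
  by exists 1; rewrite /denominator oner_neq0 rpred1 !scale0r scaler0 rpred0.
by exists c^-1; rewrite /denominator invr_neq0 // scalerA mulVf // RO rpred1.
Qed.

(** Since [F[b]] is a field, [b^-1] is a polynomial in [b] with coefficients in
    [F]; a common denominator of these coefficients makes it an element of
    [R]. *)
Lemma inverse_denominator (b : E) : b \in R -> exists d, denominator d b^-1.
Proof.
move=> bR.
have /Fadjoin_polyP[p /polyOverP pF bE] : b^-1 \in <<1%AS; b>>%VS.
  by rewrite rpredV memv_adjoin.
have [|d [d0 dO dp]] := common_denominator p.
  move=> _ /(nthP 0)[n _ <-]; have /vlineP[c ->] := pF n.
  exact: base_denominator.
exists d; split=> //; rewrite bE horner_coef scaler_sumr rpred_sum // => n _.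
by rewrite scalerAl rpredM ?rpredX // dp // mem_nth.
Qed.

Lemma fraction_denominator (z : E) :
  has_fraction_field R -> exists d, denominator d z.
Proof.
move=> /(_ z)[a [b [aR bR _ ->]]].
have [d [d0 dO db]] := inverse_denominator b bR.
by exists d; split=> //; rewrite scalerAr rpredM.
Qed.

End Denominators.

(** The [t j] are taken close to Kronecker deltas modulo [d i * e i] rather than
    [d i], so that the extra factor [e i] clears the denominators of all the
    [x_ j] at once. *)
Lemma simultaneous_approximation (F : fieldType) (E : fieldExtType F) (k : nat)
    (O : 'I_k -> subringClosed F) (R : 'I_k -> subringClosed E)
    (d : 'I_k -> F) (x_ : 'I_k -> E) :
  (forall i, valuative F (O i)) ->
  (forall i j, i != j -> independent (O i) (O j)) ->
  (forall i (a : F), (a%:A \in R i) = (a \in O i)) ->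
  (forall i, has_fraction_field (R i)) ->
  (forall i, d i != 0) ->
  exists x, forall i, (d i)^-1 *: (x - x_ i) \in R i.
Proof.
move=> valO indepO RO fracR d0.
have /fin_all_exists[e eP] i : exists e,
    [/\ e != 0, e \in O i & forall z, z \in codom x_ -> e *: z \in R i].
  apply: common_denominator (RO i) _ _ => z _.
  exact: fraction_denominator (valO i) (RO i) z (fracR i).
have e0 i : e i != 0 by have [] := eP i.
have de0 i : d i * e i != 0 by rewrite mulf_neq0.
have /fin_all_exists[t tP] j := weak_approximation F k O valO indepO j _ de0.
exists (\sum_j t j *: x_ j) => i.
have -> : x_ i = \sum_j (j == i)%:R *: x_ j.
  rewrite (bigD1 i) //= eqxx scale1r big1 ?addr0 // => j /negPf->.
  by rewrite scale0r.
rewrite -sumrB scaler_sumr rpred_sum // => j _.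
rewrite -scalerBl scalerA.
have -> : (d i)^-1 * (t j - (j == i)%:R) =
    (t j - (j == i)%:R) / (d i * e i) * e i by field; rewrite e0 d0.
have [_ _ ex] := eP i.
by rewrite -scalerA (rpredZ_base _ _ _ _ (RO i)) ?ex ?codom_f.
Qed.

(** * From rings back to values *)

Lemma subring_closed_base (F : fieldType) (E : fieldExtType F)
    (A : {pred F}) (R : {pred E}) :
  subring_closed R -> (forall a : F, (a%:A \in R) = (a \in A)) ->
  subring_closed A.
Proof.
move=> [R1 RB RM] RA; split=> [|a b|a b]; rewrite -!RA ?scale1r //.
  by rewrite scalerBl; apply: RB.
by move=> aR bR; rewrite -scalerA -mulr_algl; apply: RM.
Qed.

Lemma val_ring_valuative (F : fieldType) (G : orderedZmodType)
    (v : F -> with_infty G) : is_valuation v -> valuative F (val_ring v).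
Proof.
move=> [vinf vM _] x; rewrite !inE.
have v0 y : y != 0 -> exists a, v y = Fin a.
  by move=> /eqP y0; case vy: (v y) => [a|]; [exists a | case: y0; apply/vinf].
have [->|x0] := eqVneq x 0; first by left; have [_ ->] := vinf 0.
have [e v1] := v0 1 (oner_neq0 _).
have [a va] := v0 x x0.
have [b vb] := v0 x^-1 (invr_neq0 x0).
have := vM 1 1; rewrite mulr1 v1 => -[/eqP]; rewrite -subr_eq subrr => /eqP e0.
have := vM x x^-1; rewrite divff // v1 va vb -e0 => -[ab].
have [a0|a0] := orP (oleq_total 0 a); [by left | right].
by have := oleq_add2r b _ _ a0; rewrite -ab add0r.
Qed.

Lemma infty_le_addr (M : orderedNmodType) (x y : with_infty M) :
  Fin 0 <= y -> x <= x + y.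
Proof.
case: x y => [a|] [b|] //= b0.
by have := oleq_add2r a _ _ b0; rewrite add0r addrC.
Qed.

Lemma quasi_valuation_leM (A : nzRingType) (M : orderedNmodType)
    (w : A -> with_infty M) (x y : A) :
  is_quasi_valuation w -> y \in val_ring w -> w x <= w (x * y).
Proof.
move=> [_ wM _]; rewrite inE => y0.
exact: le_trans (infty_le_addr _ _ _ y0) (wM x y).
Qed.

Theorem theorem3p5 (F : fieldType) (E : fieldExtType F) (k : nat)
    (Gamma : 'I_k -> orderedZmodType)
    (v : forall i : 'I_k, F -> with_infty (Gamma i))
    (R : 'I_k -> {pred E})
    (M : 'I_k -> orderedNmodType)
    (iota : forall i : 'I_k, {additive Gamma i -> M i})
    (w : forall i : 'I_k, E -> with_infty (M i)) :
  (forall i, is_valuation (v i)) ->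
  (forall i, has_value_group (v i)) ->
  (forall i j, i != j -> independent (val_ring (v i)) (val_ring (v j))) ->
  (forall i, subring_closed (R i)) ->
  (forall i, has_fraction_field (R i)) ->
  (forall i (a : F), (a%:A \in R i) = (a \in val_ring (v i))) ->
  (forall i, in_W (iota i) (v i) (R i) (w i)) ->
  forall (x_ : 'I_k -> E) (m : forall i : 'I_k, M i),
  (forall i, in_MG (w i) (m i)) ->
  exists x : E, forall i, Fin (m i) <= w i (x - x_ i).
Proof.
move=> vP _ indep Rsub fracR RO wW x_ m mG.
have Osub i := subring_closed_base F E _ _ (Rsub i) (RO i).
pose O i : subringClosed F := HB.pack (val_ring (v i) : {pred F})
  (GRing.isSubringClosed.Build F _ (Osub i)).
pose R' i : subringClosed E := HB.pack (R i : {pred E})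
  (GRing.isSubringClosed.Build E _ (Rsub i)).
have valO i : valuative F (O i) := val_ring_valuative F _ (v i) (vP i).
have /fin_all_exists[d dP] i : exists d : F, d != 0 /\ Fin (m i) <= w i d%:A.
  have [y [y0 my]] := mG i; have [wq _ wR] := wW i.
  have [d [d0 _ dy]] :=
    fraction_denominator F E (O i) (R' i) (valO i) (RO i) y^-1 (fracR i).
  exists d; split=> //; apply: le_trans my _.
  have -> : d%:A = y * (d *: y^-1) by rewrite -scalerAr divff.
  by apply: quasi_valuation_leM => //; rewrite wR.
have d0 i : d i != 0 by have [] := dP i.
have [x xP] :=
  simultaneous_approximation F E k O R' d x_ valO indep RO fracR d0.
exists x => i; have [_ md] := dP i; have [wq _ wR] := wW i.
apply: le_trans md _.
have -> : x - x_ i = (d i)%:A * ((d i)^-1 *: (x - x_ i)).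
  by rewrite mulr_algl scalerA divff ?scale1r.
by apply: quasi_valuation_leM => //; rewrite wR; apply: xP.
Qed.
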